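(* Assume that $c^n\in\mathcal V_c$ satisfies $c_m\le c^n\le c_M$ at every cell center, where $0<c_m\le c_M$ and $\beta c_M\le\epsilon_0<1$, and that $\lambda>0$ satisfies $$\lambda\geq \frac{\epsilon_0}{(1-\epsilon_0)^2}+\left(\frac{\epsilon_0^2}{(1-\epsilon_0)^4}-2\ln(1-\epsilon_0)\frac{\epsilon_0}{(1-\epsilon_0)^2}\right)^{1/2}.$$ Let $c^{n+1}\in\mathcal V_c$, together with the constant $\mu_e^{n+1}\in\mathbb R$, be the solution of the fully discrete scheme $$\frac{c^{n+1}-c^n}{\tau}-\kappa\bigl(\delta_x^u[\delta_x^c[c^{n+1}]]+\delta_y^v[\delta_y^c[c^{n+1}]]\bigr)+\nu(c^n)c^{n+1}=s_r(c^n)+\mu_e^{n+1},\qquad \langle c^{n+1},1\rangle=c_t .$$ If $$\max_{c_m\le c\le c_M}\bigl(c_m\nu(c)-s_r(c)\bigr)\le \mu_e^{n+1}\le \min_{c_m\le c\le c_M}\bigl(c_M\nu(c)-s_r(c)\bigr),$$ then $c_m\le c^{n+1}\le c_M$ at every cell center.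
   Context: Mesh and operators. $\Omega=[0,l_x]\times[0,l_y]$ with $l_x,l_y>0$ carries a uniform mesh $0=x_0<\dots<x_N=l_x$, $0=y_0<\dots<y_M=l_y$ with $h=x_{i+1}-x_i=y_{j+1}-y_j$, and $x_{i+1/2}=\frac{x_i+x_{i+1}}2$, $y_{j+1/2}=\frac{y_j+y_{j+1}}2$. $\mathcal V_c$ is the space of real functions on the cell centers $(x_{i+1/2},y_{j+1/2})$, $0\le i\le N-1$, $0\le j\le M-1$, with values written $c_{i+1/2,j+1/2}$. $\mathcal V_u$ is the space of real functions on the points $(x_i,y_{j+1/2})$, $0\le i\le N$, $0\le j\le M-1$; $\mathcal V_v$ is the space of real functions on $(x_{i+1/2},y_j)$, $0\le i\le N-1$, $0\le j\le M$. For $c\in\mathcal V_c$: $\delta_x^c[c]\in\mathcal V_u$ is $\delta_x^c[c]_{i,j+1/2}=(c_{i+1/2,j+1/2}-c_{i-1/2,j+1/2})/h$ for $1\le i\le N-1$ and $0$ for $i\in\{0,N\}$; $\delta_y^c[c]\in\mathcal V_v$ is $\delta_y^c[c]_{i+1/2,j}=(c_{i+1/2,j+1/2}-c_{i+1/2,j-1/2})/h$ for $1\le j\le M-1$ and $0$ for $j\in\{0,M\}$ (homogeneous Neumann condition). For $u\in\mathcal V_u$, $v\in\mathcal V_v$: $\delta_x^u[u]_{i+1/2,j+1/2}=(u_{i+1,j+1/2}-u_{i,j+1/2})/h$ and $\delta_y^v[v]_{i+1/2,j+1/2}=(v_{i+1/2,j+1}-v_{i+1/2,j})/h$. Inner product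 on $\mathcal V_c$: $\langle c,c'\rangle=h^2\sum_{i=0}^{N-1}\sum_{j=0}^{M-1}c_{i+1/2,j+1/2}c'_{i+1/2,j+1/2}$. Nonlinear functions of elements of $\mathcal V_c$ and products are taken pointwise. Constants. $\tau>0$ (time step size), $\kappa>0$, $c_t>0$ (total moles), $\vartheta_0\in\mathbb R$, $R>0$, $T>0$ are given. The Peng-Robinson parameters are $\alpha=\alpha(T)=0.45724\frac{R^2T_c^2}{P_c}[1+m(1-\sqrt{T/T_c})]^2$ and $\beta=0.07780\frac{RT_c}{P_c}>0$, where $T_c,P_c>0$ are the critical temperature and pressure and $m$ is a real number determined by the acentric factor $\omega$: $m=0.37464+1.54226\omega-0.26992\omega^2$ if $\omega\le0.49$, and $m=0.379642+1.485030\omega-0.164423\omega^2+0.016666\omega^3$ if $\omega>0.49$. For $c\in[c_m,c_M]$ define $$G(c)=\sqrt{\lambda c-c\ln(1-\beta c)},\qquad \nu(c)=RT\Bigl(\frac1c+G'(c)^2\Bigr),$$ $$\mu_{\rm attraction}(c)=\frac{\alpha}{2\sqrt2\,\beta}\ln\Bigl(\frac{1+(1-\sqrt2)\beta c}{1+(1+\sqrt2)\beta c}\Bigr)-\frac{\alpha c}{1+2\beta c-(\beta c)^2},$$ $$s_r(c)=-\vartheta_0-RT\ln(c)+RT\bigl(G'(c)^2c-2G(c)G'(c)+\lambda\bigr)-\mu_{\rm attraction}(c).$$ The number $\mu_e^{n+1}$ is constant over the mesh and is part of the unknowns of the scheme. *)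

(* Defs.v *)
From HB Require Import structures.
From mathcomp Require Import all_boot all_order all_algebra.
From mathcomp Require Import all_classical all_reals all_analysis.
Import Order.TTheory GRing.Theory Num.Theory.
Import numFieldNormedType.Exports.

Set Implicit Arguments.
Unset Strict Implicit.
Unset Printing Implicit Defensive.

Local Open Scope classical_set_scope.
Local Open Scope ring_scope.

Section Mesh.
Context {R : realType}.

(* [lift ord_max i] and [lift ord0 i] are the nodes i and i + 1 bounding the
   i-th cell, seen in 'I_K.+1. *)
Definition uniform_mesh (K : nat) (l h : R) (x : 'I_K.+1 -> R) : Prop :=
  [/\ x ord0 = 0, x ord_max = l,
      forall i : 'I_K, x (lift ord_max i) < x (lift ord0 i) &
      forall i : 'I_K, x (lift ord0 i) - x (lift ord_max i) = h].

Variables N M : nat.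

(* The half-integer index i + 1/2 of a cell center is encoded by i. *)
Definition Vc := 'M[R]_(N, M).
Definition Vu := 'M[R]_(N.+1, M).
Definition Vv := 'M[R]_(N, M.+1).

(* [unlift ord0 i] is the cell i - 1/2 to the left of node i (None if i = 0),
   [unlift ord_max i] the cell i + 1/2 to its right (None if i = N). *)
Definition delta_xc (h : R) (c : Vc) : Vu :=
  \matrix_(i < N.+1, j < M)
    match unlift ord0 i, unlift ord_max i with
    | Some il, Some ir => (c ir j - c il j) / h
    | _, _ => 0
    end.

Definition delta_yc (h : R) (c : Vc) : Vv :=
  \matrix_(i < N, j < M.+1)
    match unlift ord0 j, unlift ord_max j with
    | Some jl, Some jr => (c i jr - c i jl) / h
    | _, _ => 0
    end.

Definition delta_xu (h : R) (u : Vu) : Vc :=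
  \matrix_(i < N, j < M) ((u (lift ord0 i) j - u (lift ord_max i) j) / h).

Definition delta_yv (h : R) (v : Vv) : Vc :=
  \matrix_(i < N, j < M) ((v i (lift ord0 j) - v i (lift ord_max j)) / h).

Definition inner_c (h : R) (c c' : Vc) : R :=
  h ^+ 2 * \sum_(i < N) \sum_(j < M) c i j * c' i j.

(* One time step of the scheme, for given pointwise functions nu and s. *)
Definition scheme (h tau kappa ct : R) (nu s : R -> R) (c0 c1 : Vc) (mu : R)
    : Prop :=
  tau^-1 *: (c1 - c0)
    - kappa *: (delta_xu h (delta_xc h c1) + delta_yv h (delta_yc h c1))
    + map2_mx *%R (map_mx nu c0) c1
    = map_mx s c0 + const_mx mu
  /\ inner_c h c1 (const_mx 1) = ct.

End Mesh.

Section PengRobinson.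
Context {R : realType}.

Definition PR_m (omega : R) : R :=
  if omega <= 49 / 10 ^+ 2 then
    37464%:R / 10 ^+ 5 + 154226%:R / 10 ^+ 5 * omega
      - 26992%:R / 10 ^+ 5 * omega ^+ 2
  else
    379642%:R / 10 ^+ 6 + 1485030%:R / 10 ^+ 6 * omega
      - 164423%:R / 10 ^+ 6 * omega ^+ 2 + 16666%:R / 10 ^+ 6 * omega ^+ 3.

Definition PR_alpha (Rg T Tc Pc omega : R) : R :=
  45724%:R / 10 ^+ 5 * (Rg ^+ 2 * Tc ^+ 2 / Pc)
    * (1 + PR_m omega * (1 - Num.sqrt (T / Tc))) ^+ 2.

Definition PR_beta (Rg Tc Pc : R) : R := 7780%:R / 10 ^+ 5 * (Rg * Tc / Pc).

(* This formula is smooth around each c with 0 < c and beta * c < 1, so at the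
   ends of the interval of interest the two-sided [derive1 G] used below agrees
   with the one-sided derivative of the restriction. *)
Definition G (lambda beta c : R) : R :=
  Num.sqrt (lambda * c - c * ln (1 - beta * c)).

Definition nu (Rg T lambda beta c : R) : R :=
  Rg * T * (c^-1 + (derive1 (G lambda beta) c) ^+ 2).

Definition mu_attraction (alpha beta c : R) : R :=
  alpha / (2 * Num.sqrt 2 * beta)
    * ln ((1 + (1 - Num.sqrt 2) * beta * c)
            / (1 + (1 + Num.sqrt 2) * beta * c))
  - alpha * c / (1 + 2 * beta * c - (beta * c) ^+ 2).

Definition s_r (Rg T theta0 lambda alpha beta c : R) : R :=
  - theta0 - Rg * T * ln c
  + Rg * T * ((derive1 (G lambda beta) c) ^+ 2 * c
              - 2 * G lambda beta c * derive1 (G lambda beta) c + lambda)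
  - mu_attraction alpha beta c.

End PengRobinson.

(* Main.v *)
Require Import Defs.
From HB Require Import structures.
From mathcomp Require Import all_boot all_order all_algebra.
From mathcomp Require Import all_classical all_reals all_analysis.
From mathcomp Require Import ring lra.
Import Order.TTheory GRing.Theory Num.Theory.
Import numFieldNormedType.Exports.
Local Open Scope classical_set_scope.
Local Open Scope ring_scope.


(* At a cell where c^{n+1} is minimal its discrete Neumann Laplacian is
   nonnegative, so c^{n+1} < cm there would make the left-hand side of the
   scheme smaller than nu(c^n) * cm, which the lower bound on mu_e forbids. The
   upper bound follows by applying the same argument to -c^{n+1}. The sup and
   inf bounding mu_e would be junk values for unbounded functions; they are
   genuine because nu and s_r are continuous on [cm, cM]. *)

(** * Sign symmetry and a discrete maximum principle for the scheme *)

Lemma delta_xc_opp {R : realType} {N M : nat} (h : R) (c : @Vc R N M) :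
  delta_xc h (- c) = - delta_xc h c.
Proof.
apply/matrixP => i j; rewrite !mxE.
by case: unlift => [a|]; [case: unlift => [b|]|]; rewrite ?mxE ?oppr0//; ring.
Qed.

Lemma delta_yc_opp {R : realType} {N M : nat} (h : R) (c : @Vc R N M) :
  delta_yc h (- c) = - delta_yc h c.
Proof.
apply/matrixP => i j; rewrite !mxE.
by case: unlift => [a|]; [case: unlift => [b|]|]; rewrite ?mxE ?oppr0//; ring.
Qed.

(** At a minimum the differences across the right and upper faces are nonnegative, those across the
    left and lower faces nonpositive, and a boundary face carries 0 by the Neumann condition. *)
Lemma laplacian_at_min_ge0 {R : realType} {N M : nat} (h : R)
  (c : @Vc R N M) (i : 'I_N) (j : 'I_M) :
  0 < h -> (forall k l, c i j <= c k l) ->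
  0 <= (delta_xu h (delta_xc h c) + delta_yv h (delta_yc h c)) i j.
Proof.
move=> h0 cmin; have d0 a b : 0 <= (c a b - c i j) / h.
  by rewrite divr_ge0 ?subr_ge0// ltW.
have d0' a b : (c i j - c a b) / h <= 0.
  by rewrite -oppr_ge0 -mulNr opprB.
(* After [liftK] the cell itself is identified on one side of each of its faces; the remaining
   [unlift] is [None] exactly when the face lies on the boundary. *)
rewrite !mxE !liftK; apply: addr_ge0; apply: divr_ge0 => //; try exact: ltW;
  rewrite subr_ge0; apply: (@le_trans _ _ 0);
  by case: unlift.
Qed.

(** The difference operators are linear, so negating all data keeps the form of the scheme. The new
    coefficient at [- c0] equals [nu] at [c0], so its sign is preserved. *)
Lemma scheme_opp {R : realType} {N M : nat} (h tau kappa ct : R)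
  (nu s : R -> R) (c0 c1 : @Vc R N M) (mu : R) :
  scheme h tau kappa ct nu s c0 c1 mu ->
  scheme h tau kappa (- ct) (fun c => nu (- c)) (fun c => - s (- c))
    (- c0) (- c1) (- mu).
Proof.
move=> [eqn mass]; split.
  rewrite delta_xc_opp delta_yc_opp; apply/matrixP => i j.
  move/matrixP/(_ i j): eqn; rewrite !mxE !opprK => eqn.
  by rewrite -opprD -eqn; ring.
rewrite -mass /inner_c -mulrN -sumrN; congr (_ * _); apply: eq_bigr => i _.
by rewrite -sumrN; apply: eq_bigr => j _; rewrite !mxE mulNr.
Qed.

(** Stated for arbitrary [nu] and [s], so that it also applies to the negated scheme. *)
Lemma scheme_ge {R : realType} {N M : nat} (h tau kappa ct : R)
  (nu s : R -> R) (c0 c1 : @Vc R N M) (mu m : R) :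
  0 < h -> 0 < tau -> 0 < kappa ->
  scheme h tau kappa ct nu s c0 c1 mu ->
  (forall i j, 0 <= nu (c0 i j)) -> (forall i j, m <= c0 i j) ->
  (forall i j, m * nu (c0 i j) - s (c0 i j) <= mu) ->
  forall i j, m <= c1 i j.
Proof.
move=> h0 tau0 kappa0 [eqn _] nu0 c0m mum i0 j0.
(* The given cell witnesses that the mesh is nonempty, so a minimizing cell exists. *)
have [[i j] _ /= imin] :=
  arg_minP (fun k => c1 k.1 k.2) (erefl : xpredT (i0, j0)).
have {}imin k l : c1 i j <= c1 k l by exact: imin (k, l) isT.
apply: le_trans (imin i0 j0); rewrite leNgt; apply/negP => c1m.
have L0 := laplacian_at_min_ge0 _ _ _ _ h0 imin.
move: L0 eqn; set L := delta_xu _ _ + _; clearbody L => L0 eqn.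
move/matrixP/(_ i j): eqn; rewrite !mxE => eqn.
(* The time difference supplies the strict inequality in the contradiction: the new value lies below
   [m], the old one does not. *)
have : tau^-1 * (c1 i j - c0 i j) < 0.
  by rewrite pmulr_rlt0 ?invr_gt0// subr_lt0 (lt_le_trans c1m).
have : 0 <= kappa * L i j by rewrite mulr_ge0// ltW.
have : nu (c0 i j) * c1 i j <= nu (c0 i j) * m by rewrite ler_wpM2l// ltW.
by move: (mum i j) eqn; lra.
Qed.

Lemma scheme_le {R : realType} {N M : nat} (h tau kappa ct : R)
  (nu s : R -> R) (c0 c1 : @Vc R N M) (mu m : R) :
  0 < h -> 0 < tau -> 0 < kappa ->
  scheme h tau kappa ct nu s c0 c1 mu ->
  (forall i j, 0 <= nu (c0 i j)) -> (forall i j, c0 i j <= m) ->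
  (forall i j, mu <= m * nu (c0 i j) - s (c0 i j)) ->
  forall i j, c1 i j <= m.
Proof.
move=> h0 tau0 kappa0 /(scheme_opp _ _ _ _ _ _ _ _ _) sch nu0 c0m mum i j.
have /(_ _ _ _ i j) := @scheme_ge _ _ _ _ _ _ _ _ _ _ _ _ (- m) h0 tau0 kappa0 sch.
rewrite mxE lerN2; apply => k l; rewrite mxE ?opprK ?lerN2//.
by rewrite lerNr opprD mulNr opprK.
Qed.

(** The nodes increase strictly, so the width of any one cell is positive; the index in ['I_K]
    provides such a cell. *)
Lemma uniform_mesh_step_gt0 {R : realType} {K : nat} (l h : R)
  (x : 'I_K.+1 -> R) : uniform_mesh l h x -> 'I_K -> 0 < h.
Proof. by move=> [_ _ lt_x step] i; rewrite -(step i) subr_gt0. Qed.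

(** * Continuity of [nu] and [s_r] where [0 < c] and [beta * c < 1] *)

Section Continuity.
Context {R : realType}.
Variables (lambda beta : R).
Hypotheses (lambda_gt0 : 0 < lambda) (beta_gt0 : 0 < beta).

Let radicand (c : R) := lambda * c - c * ln (1 - beta * c).

(** The logarithm is nonpositive, so the radicand is at least [lambda * c]. This keeps the square
    root away from 0, where it is not differentiable. *)
Lemma radicand_gt0 (c : R) : 0 < c -> beta * c < 1 -> 0 < radicand c.
Proof.
move=> c0 bc; have ln0 : ln (1 - beta * c) <= 0.
  by apply: ln_le0; rewrite gerBl mulr_ge0// ltW.
have : c * ln (1 - beta * c) <= 0 by rewrite pmulr_rle0.
by have := mulr_gt0 lambda_gt0 c0; rewrite /radicand; lra.
Qed.

Lemma G_gt0 (c : R) : 0 < c -> beta * c < 1 -> 0 < G lambda beta c.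
Proof. by move=> c0 bc; rewrite sqrtr_gt0 radicand_gt0. Qed.

(** Chain rule for the square root; the closed form reduces continuity of the derivative to that of
    elementary functions. *)
Lemma derive1_G (c : R) : 0 < c -> beta * c < 1 ->
  derive1 (G lambda beta) c =
  (lambda - ln (1 - beta * c) + beta * c / (1 - beta * c))
    / (2 * G lambda beta c).
Proof.
move=> c0 bc; have r0 := radicand_gt0 _ c0 bc.
have w0 : 0 < 1 - beta * c by rewrite subr_gt0.
have dw : is_derive c 1 (fun t : R => 1 - beta * t) (- beta).
  by apply: is_derive_eq; rewrite /GRing.scale /=; ring.
have dl : is_derive c 1 (fun t : R => ln (1 - beta * t))
    ((1 - beta * c)^-1 * - beta).
  have dl0 := is_derive1_ln w0.
  exact: (@is_derive1_comp _ (@ln R) (fun t : R => 1 - beta * t)).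
have dr : is_derive c 1 radicand
    (lambda - ln (1 - beta * c) + beta * c / (1 - beta * c)).
  apply: is_derive_eq; rewrite /GRing.scale /=.
  by field; rewrite gt_eqF.
have ds := is_derive1_sqrt r0.
have dG : is_derive c 1 (G lambda beta) _ :=
  @is_derive1_comp _ Num.sqrt radicand _ _ _ ds dr.
by rewrite derive1E (@derive_val _ _ _ _ _ _ _ dG) mulrC.
Qed.

Lemma continuous_ln1B (c : R) : beta * c < 1 ->
  {for c, continuous (fun t : R => ln (1 - beta * t))}.
Proof.
move=> bc; have w_gt0 : 0 < 1 - beta * c by rewrite subr_gt0.
have lin : {for c, continuous (fun t : R => 1 - beta * t)}.
  by apply: cvgB; [exact: cvg_cst|apply: cvgM; [exact: cvg_cst|]].
exact: cvg_comp lin (continuous_ln w_gt0).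
Qed.

Lemma continuous_G (c : R) : beta * c < 1 ->
  {for c, continuous (G lambda beta)}.
Proof.
move=> bc; have rad : {for c, continuous radicand}.
  apply: cvgB; first by apply: cvgM; [exact: cvg_cst|].
  by apply: cvgM => //; exact: continuous_ln1B.
exact: cvg_comp rad (@sqrt_continuous R _).
Qed.

(** The conditions on [c] are open, so the closed form of the derivative holds on a whole
    neighbourhood and the limit can be taken there. *)
Lemma continuous_derive1_G (c : R) : 0 < c -> beta * c < 1 ->
  {for c, continuous (derive1 (G lambda beta))}.
Proof.
move=> c0 bc; rewrite /prop_for /continuous_at derive1_G//.
have linc : {for c, continuous (fun t : R => beta * t)}.
  by apply: cvgM; [exact: cvg_cst|].
have near_c : \forall t \near c, 0 < t /\ beta * t < 1.
  by near=> t; split; near: t; [exact: lt_nbhsr|exact: (cvgr_lt _ linc)].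
pose D (t : R) := (lambda - ln (1 - beta * t) + beta * t / (1 - beta * t))
  / (2 * G lambda beta t).
have DE : {near c, D =1 derive1 (G lambda beta)}.
  by apply: filterS near_c => t [t0 bt]; rewrite derive1_G.
apply: cvg_trans (near_eq_cvg DE) _.
apply: cvgM; last first.
  apply: cvgV; first by rewrite mulf_neq0// gt_eqF// G_gt0.
  by apply: cvgM; [exact: cvg_cst|exact: continuous_G].
apply: cvgD; first by apply: cvgB; [exact: cvg_cst|exact: continuous_ln1B].
apply: cvgM => //; apply: cvgV; first by rewrite gt_eqF// subr_gt0.
by apply: cvgB => //; exact: cvg_cst.
Unshelve. all: by end_near. Qed.

Lemma continuous_nu (Rg T c : R) : 0 < c -> beta * c < 1 ->
  {for c, continuous (nu Rg T lambda beta)}.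
Proof.
move=> c0 bc; have dG := continuous_derive1_G _ c0 bc.
apply: cvgM; [exact: cvg_cst|apply: cvgD].
  by apply: cvgV => //; rewrite gt_eqF.
exact: cvgM.
Qed.

Lemma continuous_mu_attraction (alpha c : R) : 0 < c -> beta * c < 1 ->
  {for c, continuous (mu_attraction alpha beta)}.
Proof.
move=> c0 bc; have b0 := mulr_gt0 beta_gt0 c0.
(* This gives [1 - Num.sqrt 2 > -1], so with [0 < beta * c < 1] the numerator inside the logarithm
   stays positive. *)
have s2 : Num.sqrt 2 < 2 :> R.
  by rewrite -[ltRHS]ger0_norm// -sqrtr_sqr ltr_sqrt; lra.
have s0 := sqrtr_ge0 (2 : R).
have lin (a b : R) : {for c, continuous (fun t : R => a + b * beta * t)}.
  by apply: cvgD; [exact: cvg_cst|apply: cvgM; [exact: cvg_cst|]].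
have num_gt0 : 0 < 1 + (1 - Num.sqrt 2) * beta * c by nra.
have den_gt0 : 0 < 1 + (1 + Num.sqrt 2) * beta * c by nra.
(* Here [(beta * c) ^+ 2 < beta * c], since [0 < beta * c < 1]. *)
have quad_gt0 : 0 < 1 + 2 * beta * c - (beta * c) ^+ 2 by nra.
have linc : {for c, continuous (fun t : R => beta * t)}.
  by apply: cvgM; [exact: cvg_cst|].
have quot : {for c, continuous (fun t : R =>
    (1 + (1 - Num.sqrt 2) * beta * t) / (1 + (1 + Num.sqrt 2) * beta * t))}.
  by apply: cvgM; [exact: lin|apply: cvgV; rewrite ?gt_eqF//; exact: lin].
apply: cvgB.
  apply: cvgM; first exact: cvg_cst.
  exact: cvg_comp quot (continuous_ln (divr_gt0 num_gt0 den_gt0)).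
apply: cvgM; first by apply: cvgM; [exact: cvg_cst|].
apply: cvgV; first by rewrite gt_eqF.
by apply: cvgB; [exact: lin|exact: cvgM].
Qed.

Lemma continuous_s_r (Rg T theta0 alpha c : R) : 0 < c -> beta * c < 1 ->
  {for c, continuous (s_r Rg T theta0 lambda alpha beta)}.
Proof.
move=> c0 bc; have dG := continuous_derive1_G _ c0 bc.
have cG := continuous_G _ bc.
apply: cvgB; last exact: continuous_mu_attraction.
apply: cvgD.
  apply: cvgB; [exact: cvg_cst|apply: cvgM; [exact: cvg_cst|]].
  exact: continuous_ln.
apply: cvgM; [exact: cvg_cst|apply: cvgD; last exact: cvg_cst].
apply: cvgB; first by apply: cvgM => //; exact: cvgM.
by apply: cvgM => //; apply: cvgM => //; exact: cvg_cst.
Qed.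

End Continuity.

Theorem theorem5p2 (R : realType)
  (N M : nat) (lx ly h : R) (x : 'I_N.+1 -> R) (y : 'I_M.+1 -> R)
  (lx_gt0 : 0 < lx) (ly_gt0 : 0 < ly)
  (mesh_x : uniform_mesh lx h x) (mesh_y : uniform_mesh ly h y)
  (tau kappa ct theta0 Rg T Tc Pc omega alpha beta : R)
  (tau_gt0 : 0 < tau) (kappa_gt0 : 0 < kappa) (ct_gt0 : 0 < ct)
  (Rg_gt0 : 0 < Rg) (T_gt0 : 0 < T) (Tc_gt0 : 0 < Tc) (Pc_gt0 : 0 < Pc)
  (alphaE : alpha = PR_alpha Rg T Tc Pc omega)
  (betaE : beta = PR_beta Rg Tc Pc)
  (cm cM eps0 lambda : R)
  (cm_gt0 : 0 < cm) (cm_le_cM : cm <= cM)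
  (beta_cM : beta * cM <= eps0) (eps0_lt1 : eps0 < 1)
  (lambda_gt0 : 0 < lambda)
  (lambda_ge :
     eps0 / (1 - eps0) ^+ 2
     + Num.sqrt (eps0 ^+ 2 / (1 - eps0) ^+ 4
                 - 2 * ln (1 - eps0) * (eps0 / (1 - eps0) ^+ 2)) <= lambda)
  (cn : @Vc R N M)
  (cn_bound : forall i j, cm <= cn i j <= cM)
  (cn1 : @Vc R N M) (mu_e : R)
  (cn1_scheme :
     scheme h tau kappa ct (nu Rg T lambda beta)
       (s_r Rg T theta0 lambda alpha beta) cn cn1 mu_e)
  (mu_ge :
     sup [set cm * nu Rg T lambda beta c - s_r Rg T theta0 lambda alpha beta c
         | c in `[cm, cM]] <= mu_e)
  (mu_le :
     mu_e <= inf [set cM * nu Rg T lambda beta c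
                      - s_r Rg T theta0 lambda alpha beta c
                 | c in `[cm, cM]]) :
  forall (i : 'I_N) (j : 'I_M), cm <= cn1 i j <= cM.
Proof.
have beta_gt0 : 0 < beta.
  by rewrite betaE mulr_gt0// ?divr_gt0 ?mulr_gt0// ?exprn_gt0 ?ltr0n.
have inside c : cm <= c <= cM -> 0 < c /\ beta * c < 1.
  move=> /andP[mc cM_]; split; first exact: lt_le_trans mc.
  by rewrite (le_lt_trans _ eps0_lt1)// (le_trans _ beta_cM)// ler_pM2l.
(* The factor [k] will be [cm] for the supremum and [cM] for the infimum. *)
have cont k : {within `[cm, cM], continuous (fun c : R =>
    k * nu Rg T lambda beta c - s_r Rg T theta0 lambda alpha beta c)}.
  apply: continuous_in_subspaceT => c; rewrite inE/= in_itv/= => /inside[c0 bc].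
  apply: cvgB; last exact: continuous_s_r.
  by apply: cvgM; [exact: cvg_cst|exact: continuous_nu].
have nu_ge0 i j : 0 <= nu Rg T lambda beta (cn i j).
  have [c0 _] := inside _ (cn_bound i j).
  by rewrite mulr_ge0 ?mulr_ge0 ?addr_ge0 ?sqr_ge0 ?invr_ge0// ltW.
move=> i j; have h0 := uniform_mesh_step_gt0 _ _ _ mesh_x i.
apply/andP; split.
  apply: (scheme_ge _ _ _ _ _ _ _ _ _ _ h0 tau_gt0 kappa_gt0 cn1_scheme nu_ge0) => k l.
    by case/andP: (cn_bound k l).
  (* The value at a cell belongs to the image set because [cn] stays in the interval; the maximum of
     the continuous function bounds that set, so [sup] really dominates it. *)
  apply: le_trans mu_ge; apply: ub_le_sup; last first.
    by exists (cn k l) => //=; rewrite in_itv/=; exact: cn_bound.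
  have [a _ amax] := EVT_max cm_le_cM (cont cm).
  by eexists => _ [c cI <-]; exact: amax.
apply: (scheme_le _ _ _ _ _ _ _ _ _ _ h0 tau_gt0 kappa_gt0 cn1_scheme nu_ge0) => k l.
  by case/andP: (cn_bound k l).
apply: (le_trans mu_le); apply: ge_inf; last first.
  by exists (cn k l) => //=; rewrite in_itv/=; exact: cn_bound.
(* The attained minimum provides the lower bound that makes [inf] genuine. *)
have [a _ amin] := EVT_min cm_le_cM (cont cM).
by eexists => _ [c cI <-]; exact: amin.
Qed.
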